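(* Let $F$ be a field, let $D$ be a unital $F$-algebra with an involution $\sigma:D\to D$, and let $c\in D$ be an invertible element not contained in $F$ with $\sigma(c)\neq c$. Let $A=\mathrm{Cay}(D,c)$, resp. $A=\mathrm{Cay}_m(D,c)$, $A=\mathrm{Cay}_r(D,c)$, $A=\mathrm{Cay}^l(D,c)$, $A=\mathrm{Cay}^l_m(D,c)$ or $A=\mathrm{Cay}^r_r(D,c)$. Then: (i) $D$ is a subalgebra of $A$. (ii) If there is a unital subalgebra with involution $(B,\sigma)$ of $(D,\sigma)$ such that $c\in B^\times$, then the algebra $\mathrm{Cay}(B,c)$, resp. $\mathrm{Cay}_m(B,c)$, $\mathrm{Cay}_r(B,c)$, $\mathrm{Cay}^l(B,c)$, $\mathrm{Cay}^l_m(B,c)$ or $\mathrm{Cay}^r_r(B,c)$, is a subalgebra of $A$. (iii) $A$ is not third power-associative and not quadratic.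
   Context: Algebras are finite-dimensional, unital and not necessarily associative. An involution is an $F$-linear anti-automorphism of order at most 2. An algebra is third power-associative if $u^2u=uu^2$ for all its elements $u$; a unital $F$-algebra is quadratic if every element $x$ satisfies an equation $x^2-t x+n1=0$ with $t,n\in F$. $D$ is identified with $D\oplus 0$. For $D,\sigma,c$ as in the claim, the $F$-vector space $D\oplus D$ is made into a unital $F$-algebra with unit $(1,0)$ by the following multiplications ($u,v,u',v'\in D$): $\mathrm{Cay}(D,c)$: $(u,v)(u',v')=(uu'+c(\sigma(v')v),\ v'u+v\sigma(u'))$; $\mathrm{Cay}_m(D,c)$: $(u,v)(u',v')=(uu'+\sigma(v')(cv),\ v'u+v\sigma(u'))$; $\mathrm{Cay}_r(D,c)$: $(u,v)(u',v')=(uu'+(\sigma(v')v)c,\ v'u+v\sigma(u'))$; and, if $D$ is not associative, also $\mathrm{Cay}^l(D,c)$: $(u,v)(u',v')=(uu'+(c\sigma(v'))v,\ v'u+v\sigma(u'))$; $\mathrm{Cay}^l_m(D,c)$: $(u,v)(u',v')=(uu'+(\sigma(v')c)v,\ v'u+v\sigma(u'))$; $\mathrm{Cay}^r_r(D,c)$: $(u,v)(u',v')=(uu'+\sigma(v')(vc),\ v'u+v\sigma(u'))$. For a subalgebra $B$ as in (ii) the algebras $\mathrm{Cay}(B,c)$ etc. are defined by the same formulas on $B\oplus B\subset D\oplus D$, using the restriction of $\sigma$. *)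

(* Defs.v *)
From HB Require Import structures.
From mathcomp Require Import all_boot all_algebra.

Set Implicit Arguments.
Unset Strict Implicit.
Unset Printing Implicit Defensive.

Import GRing.Theory.

Reserved Notation "x ** y" (at level 40, left associativity).

Notation "x ** y" := (monoid.mul x y) : ring_scope.

Local Open Scope ring_scope.

(* Finite-dimensional unital F-algebras, not necessarily associative: the      *)
(* product and the unit are those of a unital magma.  Nothing excludes the     *)
(* zero algebra.                                                               *)
HB.mixin Record isBilinearMul (F : fieldType) A
    of Vector F A & UMagma A := {
  mulgDZl : forall (a : F) (x y z : A),
    (a *: x + y) ** z = a *: (x ** z) + y ** z;
  mulgDZr : forall (a : F) (x y z : A),
    z ** (a *: x + y) = a *: (z ** x) + z ** y
}.

#[short(type="naAlgType")]
HB.structure Definition NAAlgebra (F : fieldType) :=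
  {A of Vector F A & UMagma A & isBilinearMul F A}.

Section Algebras.

Variable F : fieldType.
Implicit Types A B D : naAlgType F.

Lemma mulgDl A (x y z : A) : (x + y) ** z = x ** z + y ** z.
Proof. by have := mulgDZl 1 x y z; rewrite !scale1r. Qed.

Lemma mulgDr A (x y z : A) : z ** (x + y) = z ** x + z ** y.
Proof. by have := mulgDZr 1 x y z; rewrite !scale1r. Qed.

Lemma mulg0l A (z : A) : 0 ** z = 0.
Proof. by apply: (@addIr _ (0 ** z)); rewrite -mulgDl !add0r. Qed.

Lemma mulg0r A (z : A) : z ** 0 = 0.
Proof. by apply: (@addIr _ (z ** 0)); rewrite -mulgDr !add0r. Qed.

Lemma mulgZl A (a : F) (x z : A) : (a *: x) ** z = a *: (x ** z).
Proof. by have := mulgDZl a x 0 z; rewrite mulg0l !addr0. Qed.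

Lemma mulgZr A (a : F) (x z : A) : z ** (a *: x) = a *: (z ** x).
Proof. by have := mulgDZr a x 0 z; rewrite mulg0r !addr0. Qed.

Definition invertible A (x : A) : Prop :=
  exists y : A, x ** y = 1%g /\ y ** x = 1%g.

Definition third_power_associative A : Prop :=
  forall u : A, (u ** u) ** u = u ** (u ** u).

Definition quadratic A : Prop :=
  forall x : A, exists t n : F, x ** x - t *: x + n *: 1%g = 0.

Record involution D := Involution {
  inv_fun :> {linear D -> D};
  invMr : forall x y : D, inv_fun (x ** y) = inv_fun y ** inv_fun x;
  invKr : forall x : D, inv_fun (inv_fun x) = x
}.

Lemma inv1 D (s : involution D) : s 1%g = 1%g.
Proof. by rewrite -{1}[s 1%g]mulg1 -{2}[1%g](invKr s) -invMr mulg1 invKr. Qed.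

Record subalg A := Subalg {
  subalg_vspace :> {vspace A};
  subalg_closed : umagma_closed subalg_vspace
}.

(* The injection f identifies the algebra B with a unital subalgebra of A. *)
Definition subalgebra_via B A (f : B -> A) : Prop :=
  [/\ linear f, injective f, f 1%g = 1%g, {morph f : x y / x ** y}
    & exists S : subalg A, forall x : A, x \in S <-> exists y : B, f y = x].

End Algebras.

Section SubalgebraInstance.

Variables (F : fieldType) (A : naAlgType F) (S : subalg A).
Implicit Types x y z : subvs_of S.

Definition subvs_mul x y : subvs_of S :=
  Subvs ((subalg_closed S).2 _ _ (subvsP x) (subvsP y)).

Definition subvs_one : subvs_of S := Subvs (subalg_closed S).1.

Lemma subvs_mul1g : left_id subvs_one subvs_mul.
Proof. by move=> x; apply: val_inj; rewrite /= mul1g. Qed.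

Lemma subvs_mulg1 : right_id subvs_one subvs_mul.
Proof. by move=> x; apply: val_inj; rewrite /= mulg1. Qed.

HB.instance Definition _ := hasMul.Build (subvs_of S) subvs_mul.
HB.instance Definition _ :=
  Magma_isUMagma.Build (subvs_of S) subvs_mul1g subvs_mulg1.

Lemma subvs_mulgDZl (a : F) x y z : (a *: x + y) ** z = a *: (x ** z) + y ** z.
Proof. by apply: val_inj; rewrite /= mulgDZl. Qed.

Lemma subvs_mulgDZr (a : F) x y z : z ** (a *: x + y) = a *: (z ** x) + z ** y.
Proof. by apply: val_inj; rewrite /= mulgDZr. Qed.

HB.instance Definition _ :=
  isBilinearMul.Build F (subvs_of S) subvs_mulgDZl subvs_mulgDZr.

Variables (s : involution A) (sS : forall x : A, x \in S -> s x \in S).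

Definition restr_fun x : subvs_of S := Subvs (sS (subvsP x)).

Lemma restr_fun_linear : linear restr_fun.
Proof. by move=> a x y; apply: val_inj; rewrite /= linearP. Qed.

HB.instance Definition _ :=
  GRing.isLinear.Build F (subvs_of S) (subvs_of S) *:%R restr_fun
    restr_fun_linear.

Lemma restr_funM x y : restr_fun (x ** y) = restr_fun y ** restr_fun x.
Proof. by apply: val_inj; rewrite /= invMr. Qed.

Lemma restr_funK x : restr_fun (restr_fun x) = x.
Proof. by apply: val_inj; rewrite /= invKr. Qed.

Definition restr_involution : involution (subvs_of S) :=
  Involution restr_funM restr_funK.

End SubalgebraInstance.

(* The letter glued to Cay is an upper index, the one after _ a lower index.   *)
Inductive doubling := Cay | Cay_m | Cay_r | Cayl | Cayl_m | Cayr_r.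

(* The doublings with an upper index are only considered for nonassociative D: *)
(* when D is associative they coincide with Cay, Cay_m and Cay_r.              *)
Definition nonassoc_only (k : doubling) : bool :=
  match k with Cay | Cay_m | Cay_r => false | _ => true end.

Section Doubling.

Variables (F : fieldType) (D : naAlgType F).

Definition twist (k : doubling) (c v' v : D) : D :=
  match k with
  | Cay    => c ** (v' ** v)
  | Cay_m  => v' ** (c ** v)
  | Cay_r  => (v' ** v) ** c
  | Cayl   => (c ** v') ** v
  | Cayl_m => (v' ** c) ** v
  | Cayr_r => v' ** (v ** c)
  end.

(* The doubled algebra is an alias of D * D: the pair type itself carries the  *)
(* componentwise product.                                                      *)
Definition cay (k : doubling) (s : involution D) (c : D) : Type := (D * D)%type.

Variables (k : doubling) (s : involution D) (c : D).

HB.instance Definition _ := Vector.on (cay k s c).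

Implicit Types x y z : cay k s c.

Definition cay_mul x y : cay k s c :=
  (x.1 ** y.1 + twist k c (s y.2) x.2, y.2 ** x.1 + x.2 ** s y.1).

Definition cay_one : cay k s c := (1%g, 0).

Lemma twistDZl (a : F) (u v w : D) :
  twist k c (a *: u + v) w = a *: twist k c u w + twist k c v w.
Proof. by case: k; rewrite /= ?(mulgDZl, mulgDZr). Qed.

Lemma twistDZr (a : F) (u v w : D) :
  twist k c w (a *: u + v) = a *: twist k c w u + twist k c w v.
Proof. by case: k; rewrite /= ?(mulgDZl, mulgDZr). Qed.

Lemma twist0l (w : D) : twist k c 0 w = 0.
Proof. by case: k; rewrite /= ?(mulg0l, mulg0r). Qed.

Lemma twist0r (w : D) : twist k c w 0 = 0.
Proof. by case: k; rewrite /= ?(mulg0l, mulg0r). Qed.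

Lemma cay_mul1g : left_id cay_one cay_mul.
Proof.
by case=> u v; rewrite /cay_mul /= twist0r mul1g mulg1 mulg0l !addr0.
Qed.

Lemma cay_mulg1 : right_id cay_one cay_mul.
Proof.
by case=> u v; rewrite /cay_mul /= linear0 twist0l inv1 !mulg1 mulg0l addr0 add0r.
Qed.

HB.instance Definition _ := hasMul.Build (cay k s c) cay_mul.
HB.instance Definition _ :=
  Magma_isUMagma.Build (cay k s c) cay_mul1g cay_mulg1.

Lemma cay_mulgDZl (a : F) x y z : (a *: x + y) ** z = a *: (x ** z) + y ** z.
Proof.
by congr (_, _); rewrite /= ?twistDZr ?mulgDZl ?mulgDZr scalerDr addrACA.
Qed.

Lemma cay_mulgDZr (a : F) x y z : z ** (a *: x + y) = a *: (z ** x) + z ** y.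
Proof.
by congr (_, _); rewrite /= !linearP /= ?twistDZl ?mulgDZl ?mulgDZr scalerDr addrACA.
Qed.

HB.instance Definition _ :=
  isBilinearMul.Build F (cay k s c) cay_mulgDZl cay_mulgDZr.

End Doubling.

(* Main.v *)
(* Negative results: for w = (0, 1) every doubling gives w w = (c, 0), because  *)
(* twist k c 1 1 = c.  Then (w w) w = (0, c) while w (w w) = (0, sigma c), and  *)
(* a quadratic equation for w would force c to be a scalar.                     *)
From HB Require Import structures.
Require Import Defs.
From mathcomp Require Import all_boot all_algebra.

Import GRing.Theory.
Local Open Scope ring_scope.

(** Both embeddings are componentwise linear injections, so only multiplicativity matters. On [D]
    the twisted term vanishes with the second coordinates; on [B] it is a product of elements of
    [B]. The square of [(0, 1)] refutes the two identities. *)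

(** The subalgebra required is the image of [f]: a subspace by linearity, closed because [f]
    preserves products and unit. *)
Lemma subalgebra_viaP (F : fieldType) (B A : naAlgType F) (f : B -> A) :
  linear f -> injective f -> f 1%g = 1%g -> {morph f : x y / x ** y} ->
  subalgebra_via f.
Proof.
move=> flin finj f1 fM.
pose fL := GRing.isLinear.Build F B A *:%R f flin.
pose g : {linear B -> A} := HB.pack f fL.
have imgP x : reflect (exists y, f y = x) (x \in limg (linfun g)).
  apply: (iffP memv_imgP) => [[y _ ->]|[y <-]]; exists y; by rewrite ?memvf ?lfunE.
have img_closed : umagma_closed (limg (linfun g)).
  split=> [|_ _ /imgP[x <-] /imgP[y <-]]; apply/imgP; first by exists 1%g.
  by exists (x ** y).
by split=> //; exists (Subalg img_closed) => x; split=> /imgP.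
Qed.

Theorem lemma4 (F : fieldType) (D : naAlgType F) (sigma : involution D) (c : D)
    (c_inv : invertible c) (cF : c \notin <[1%g : D]>%VS) (sc : sigma c <> c)
    (k : doubling) (Dk : nonassoc_only k -> ~ associative (@monoid.mul D)) :
  [/\ subalgebra_via (fun u : D => (u, 0%R) : cay k sigma c),
      forall (B : subalg D) (sB : forall x : D, x \in B -> sigma x \in B)
             (cB : subvs_of B), vsval cB = c -> invertible cB ->
        subalgebra_via (fun w : cay k (restr_involution sB) cB =>
                          (vsval w.1, vsval w.2) : cay k sigma c)
    & ~ third_power_associative (cay k sigma c) /\ ~ quadratic (cay k sigma c)].
Proof.
have sqr01 : ((0, 1%g) : cay k sigma c) ** (0, 1%g) = (c, 0).
  congr (_, _); rewrite /= ?linear0 ?mulg0l ?mulg0r ?addr0 // add0r inv1.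
  by case: (k); rewrite /= ?(mul1g, mulg1).
split.
- apply: subalgebra_viaP => [a x y|x y []//|//|x y].
  + by congr (_, _); rewrite /= scaler0 addr0.
  + by congr (_, _); rewrite /= ?twist0r ?mulg0l ?addr0.
- move=> B sB cB cBc _; apply: subalgebra_viaP => [a x y|x y|//|x y].
  + by congr (_, _); rewrite /= linearP.
  + by case: x y => [x1 x2] [y1 y2] [/val_inj-> /val_inj->].
  (* With [c] written as [vsval cB], both twists agree by computation for each [k]. *)
  + by congr (_, _); rewrite /= -cBc; case: (k).
- split=> [/(_ (0, 1%g))|/(_ (0, 1%g)) [t [n]]]; rewrite sqr01.
  + by case=> _; rewrite mul1g !mulg0l addr0 add0r mul1g => /esym.
  (* [t *: (0, 1)] has first component 0, so that component reads [c + n *: 1 = 0]. *)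
  + case=> cn _; move/negP: cF; apply; apply/vlineP; exists (- n).
    by move/eqP: cn; rewrite scaler0 subr0 addr_eq0 -scaleNr => /eqP.
Qed.
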